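(* Let $A\in\mathbb{C}^{n\times n}$ have index $k$, let $m$ be a positive integer, and let $X\in\mathbb{C}^{n\times n}$. Then the following statements are equivalent: (a) $X=A^{\mathrm{w}_m,\dagger}$; (b) $AX=P_{\mathcal{R}(A^k),\,\mathcal{N}((A^k)^*A^{m+1}A^\dagger)}$, $XA=P_{\mathcal{R}(A^k),\,\mathcal{N}((A^k)^*A^{m+1})}$ and $r(X)=r(A^k)$; (c) $AX=P_{\mathcal{R}(A^k),\,\mathcal{N}((A^k)^*A^{m+1}A^\dagger)}$, $XA=P_{\mathcal{R}(A^k),\,\mathcal{N}((A^k)^*A^{m+1})}$ and $AX^2=X$; (d) $AX=P_{\mathcal{R}(A^k),\,\mathcal{N}((A^k)^*A^{m+1}A^\dagger)}$, $XA=P_{\mathcal{R}(A^k),\,\mathcal{N}((A^k)^*A^{m+1})}$ and $XAX=X$.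
   Context: $r(\cdot)$, $\mathcal{R}(\cdot)$, $\mathcal{N}(\cdot)$, $(\cdot)^*$ denote rank, range, null space and conjugate transpose; $A^\dagger$ is the Moore-Penrose inverse and $A^D$ the Drazin inverse. The index of $A\in\mathbb{C}^{n\times n}$ is the smallest nonnegative integer $k$ with $r(A^{k+1})=r(A^k)$ (with $A^0=I_n$). For subspaces with $\mathcal{L}\oplus\mathcal{M}=\mathbb{C}^n$, $P_{\mathcal{L},\mathcal{M}}$ is the projector onto $\mathcal{L}$ along $\mathcal{M}$ (the pairs of subspaces appearing in the claim are complementary in $\mathbb{C}^n$). For $A$ of index $k$, the core-EP inverse is $A^{\mathrm{cEP}}=A^DA^k(A^k)^\dagger$ and the $m$-weak group inverse is $A^{\mathrm{w}_m}=(A^{\mathrm{cEP}})^{m+1}A^m$. The $m$-weak group MP inverse $A^{\mathrm{w}_m,\dagger}$ is the unique $Y\in\mathbb{C}^{n\times n}$ satisfying $YAY=Y$, $AY=A_1A^\dagger$ and $YA=A^DA_1$, where $A_1=AA^{\mathrm{w}_m}A$. *)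

(* Defs.v *)
From HB Require Import structures.
From mathcomp Require Import all_boot all_order all_algebra.

Set Implicit Arguments.
Unset Strict Implicit.
Unset Printing Implicit Defensive.

Import Order.TTheory GRing.Theory Num.Theory.
Local Open Scope ring_scope.
Local Open Scope sesquilinear_scope.

Section ConjTranspose.
Variable C : numClosedFieldType.

Lemma ctmxK m n (A : 'M[C]_(m, n)) : A ^t* ^t* = A.
Proof. by apply/matrixP => i j; rewrite !mxE conjCK. Qed.

Lemma ctmxM m n p (A : 'M[C]_(m, n)) (B : 'M[C]_(n, p)) :
  (A *m B) ^t* = B ^t* *m A ^t*.
Proof. by rewrite trmx_mul map_mxM. Qed.

Lemma ctmx_mul_eq0 m n (A : 'M[C]_(m, n)) : A ^t* *m A = 0 -> A = 0.
Proof.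
move=> /matrixP AA0; apply/matrixP => i j; rewrite mxE.
have /eqP := AA0 j j; rewrite !mxE psumr_eq0.
  move=> /allP /(_ i); rewrite mem_index_enum => /(_ isT) /=.
  by rewrite !mxE mulrC -normCK expf_eq0 /= normr_eq0 => /eqP.
by move=> l _; rewrite !mxE mulrC -normCK exprn_ge0.
Qed.

Lemma sub_ctmx_mul m n (A : 'M[C]_(m, n)) : (A <= A ^t* *m A)%MS.
Proof.
rewrite submxE; apply/eqP; set K := cokermx _.
apply: ctmx_mul_eq0; rewrite ctmxM mulmxA -(mulmxA _ _ A) -mulmxA.
by rewrite mulmx_coker mulmx0.
Qed.

End ConjTranspose.

Section MoorePenrose.
Variable C : numClosedFieldType.

Definition is_mpinv m n (A : 'M[C]_(m, n)) (X : 'M[C]_(n, m)) : bool :=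
  [&& A *m X *m A == A, X *m A *m X == X,
      (A *m X) ^t* == A *m X & (X *m A) ^t* == X *m A].

Lemma mpinv_exists m n (A : 'M[C]_(m, n)) : exists X, is_mpinv A X.
Proof.
have /submxP[D AD] := sub_ctmx_mul A.
have /submxP[F AF] := sub_ctmx_mul (A ^t*).
rewrite ctmxK in AF.
have AD' : A ^t* = A ^t* *m A *m D ^t*.
  by rewrite {1}AD !ctmxM ctmxK.
have AF' : A = A *m A ^t* *m F ^t*.
  by rewrite -{1}(ctmxK A) {1}AF !ctmxM !ctmxK.
have AFA : A *m F *m A = A.
  transitivity (A *m (F *m (A *m A ^t*)) *m F ^t*); last by rewrite -AF -AF'.
  by rewrite {2}AF' !mulmxA.
have ADA : A *m D ^t* *m A = A.
  transitivity (D *m (A ^t* *m A *m D ^t*) *m A); last first.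
    by rewrite -AD' -mulmxA -AD.
  by rewrite {1}AD !mulmxA.
exists (F *m A *m D ^t*); rewrite /is_mpinv.
have -> : A *m (F *m A *m D ^t*) = A *m D ^t* by rewrite !mulmxA AFA.
have -> : F *m A *m D ^t* *m A = F *m A by rewrite -!mulmxA (mulmxA A) ADA.
apply/and4P; split; apply/eqP => //.
- by rewrite !mulmxA -(mulmxA F A F) -(mulmxA F (A *m F)) AFA.
- have -> : A *m D ^t* = D *m (A ^t* *m A) *m D ^t* by rewrite -AD.
  by rewrite !ctmxM !ctmxK !mulmxA.
- have -> : F *m A = F *m (A *m A ^t*) *m F ^t* by rewrite -mulmxA -AF'.
  by rewrite !ctmxM !ctmxK !mulmxA.
Qed.

Definition mpinv m n (A : 'M[C]_(m, n)) : 'M[C]_(n, m) :=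
  xchoose (mpinv_exists A).

Lemma mpinvP m n (A : 'M[C]_(m, n)) : is_mpinv A (mpinv A).
Proof. exact: xchooseP. Qed.

Lemma mpinv_unique m n (A : 'M[C]_(m, n)) X Y :
  is_mpinv A X -> is_mpinv A Y -> X = Y.
Proof.
move=> /and4P[/eqP x1 /eqP x2 /eqP x3 /eqP x4].
move=> /and4P[/eqP y1 /eqP y2 /eqP y3 /eqP y4].
have XY : A *m X = A *m Y.
  by rewrite -x3 -{1}y1 -(mulmxA (A *m Y)) ctmxM x3 y3 mulmxA x1.
have YX : X *m A = Y *m A.
  by rewrite -x4 -{1}y1 -!mulmxA mulmxA ctmxM x4 y4 -mulmxA (mulmxA A) x1.
by rewrite -x2 YX -mulmxA XY mulmxA y2.
Qed.

End MoorePenrose.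

Section Drazin.
Variables (F : fieldType) (n : nat).
Implicit Types A X Y : 'M[F]_n.

Lemma mxindex_exists A : exists k, \rank (A ^+ k.+1) == \rank (A ^+ k).
Proof.
have rk k : (\rank (A ^+ k.+1) <= \rank (A ^+ k))%N.
  by rewrite exprS mxrankM_maxr.
have [/existsP[k /eqP kP]|/existsPn nk] :=
  boolP [exists k : 'I_n.+1, \rank (A ^+ k.+1) == \rank (A ^+ k)].
  by exists k; apply/eqP.
suff H k : (k <= n.+1)%N -> (\rank (A ^+ k) + k <= n)%N.
  by have := H n.+1 (leqnn _); rewrite addnS ltnNge leq_addl.
elim: k => [|k IH] kn; first by rewrite addn0 rank_leq_row.
have := nk (Ordinal kn); rewrite /= => ne.
apply: leq_trans (IH (ltnW kn)).
by rewrite addnS -addSn leq_add2r ltn_neqAle ne rk.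
Qed.

Definition mxindex A : nat := ex_minn (mxindex_exists A).

Lemma mxindexP A :
  \rank (A ^+ (mxindex A).+1) = \rank (A ^+ mxindex A) /\
  (forall j, \rank (A ^+ j.+1) = \rank (A ^+ j) -> (mxindex A <= j)%N).
Proof.
rewrite /mxindex; case: ex_minnP => k /eqP kP kmin; split=> // j /eqP.
exact: kmin.
Qed.

Definition is_drazin A X : bool :=
  [&& X *m A *m X == X, A *m X == X *m A
    & X *m A ^+ (mxindex A).+1 == A ^+ mxindex A].

Lemma drazin_exists A : exists X, is_drazin A X.
Proof.
rewrite /is_drazin; have [rkA _] := mxindexP A; move: (mxindex A) rkA => k rkA.
have /submxP[D AD] : (A ^+ k <= A ^+ k.+1)%MS.
  have S : (A ^+ k.+1 <= A ^+ k)%MS by rewrite exprS submxMl.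
  by rewrite -(mxrank_leqif_sup S) rkA.
have /submxP[E' AE'] : ((A ^+ k)^T <= (A ^+ k.+1)^T)%MS.
  have S : ((A ^+ k.+1)^T <= (A ^+ k)^T)%MS by rewrite exprSr trmx_mul submxMl.
  by rewrite -(mxrank_leqif_sup S) !mxrank_tr rkA.
have AE : A ^+ k = A ^+ k.+1 *m E'^T.
  by rewrite -[LHS]trmxK AE' trmx_mul trmxK.
move: (E'^T) AE => E AE {E' AE'}.
have eD : A ^+ k = D * (A ^+ k.+1) := AD.
have eE : A ^+ k = A ^+ k.+1 * E := AE.
have DE : D * A ^+ k = A ^+ k * E by rewrite {1}eE mulrA -eD.
have DEj j : D ^+ j * A ^+ k = A ^+ k * E ^+ j.
  elim: j => [|j IH]; first by rewrite !expr0 mul1r mulr1.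
  by rewrite exprSr -mulrA DE mulrA IH -mulrA -exprSr.
have Dj j : D ^+ j * A ^+ (k + j) = A ^+ k.
  elim: j => [|j IH]; first by rewrite expr0 mul1r addn0.
  by rewrite exprSr addnS -addSn exprD mulrA -(mulrA _ D) -eD -mulrA -exprD.
have Ej j : A ^+ (k + j) * E ^+ j = A ^+ k.
  elim: j => [|j IH]; first by rewrite expr0 mulr1 addn0.
  rewrite addnS -addSn addnC exprD (exprS E) mulrA -(mulrA (A ^+ j)) -eE.
  by rewrite -exprD addnC.
have XA : D ^+ k.+1 * A ^+ k * A = D ^+ k * A ^+ k.
  by rewrite -mulrA -exprSr exprSr -mulrA -eD.
have AX : A * (D ^+ k.+1 * A ^+ k) = D ^+ k * A ^+ k.
  by rewrite !DEj mulrA -exprS (exprS E) mulrA -eE.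
exists (D ^+ k.+1 * A ^+ k); apply/and3P; split; apply/eqP.
- change (D ^+ k.+1 * A ^+ k * A * (D ^+ k.+1 * A ^+ k) = D ^+ k.+1 * A ^+ k).
  by rewrite XA (DEj k.+1) mulrA -(mulrA (D ^+ k)) -exprD Dj.
- by change (A * (D ^+ k.+1 * A ^+ k) = D ^+ k.+1 * A ^+ k * A); rewrite AX XA.
- change (D ^+ k.+1 * A ^+ k * A ^+ k.+1 = A ^+ k).
  by rewrite -mulrA -exprD Dj.
Qed.

Definition drazin A : 'M[F]_n := xchoose (drazin_exists A).

Lemma drazinP A : is_drazin A (drazin A).
Proof. exact: xchooseP. Qed.

Lemma drazin_unique A X Y : is_drazin A X -> is_drazin A Y -> X = Y.
Proof.
move=> /and3P[/eqP x1 /eqP x2 /eqP x3] /and3P[/eqP y1 /eqP y2 /eqP y3].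
move: (mxindex A) x3 y3 => k x3 y3.
have powl Z j : Z *m A *m Z = Z -> A *m Z = Z *m A -> Z = A ^+ j *m Z ^+ j.+1.
  move=> z1 z2; elim: j => [|j IH]; first by rewrite expr0 expr1 mul1mx.
  rewrite exprSr; change (Z = A ^+ j * A * Z ^+ j.+2).
  rewrite (exprS Z j.+1) (exprS Z j) !mulrA -(mulrA (A ^+ j)).
  rewrite -(mulrA _ (A * Z)) (_ : A * Z * Z = Z); last first.
    by rewrite -[RHS]z1 -z2.
  by rewrite -mulrA -exprS.
have powr Z j : Z *m A *m Z = Z -> A *m Z = Z *m A -> Z = Z ^+ j.+1 *m A ^+ j.
  move=> z1 z2; rewrite {1}(powl Z j z1 z2).
  by have cAZ : GRing.comm A Z := z2; apply: commrX; apply/commr_sym/commrX.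
have e1 : X = Y *m A *m X.
  rewrite {1}(powl X k x1 x2) -y3 -(mulmxA Y) -!mulmxA; congr (_ *m _).
  rewrite [in RHS](powl X k x1 x2).
  change (A ^+ k.+1 * X ^+ k.+1 = A * (A ^+ k * X ^+ k.+1)).
  by rewrite mulrA -exprS.
have e2 : Y = Y *m A *m X.
  have x3' : A ^+ k = A ^+ k.+1 *m X.
    have cXA : GRing.comm X A := esym x2.
    by rewrite -x3; exact: (commrX k.+1 cXA).
  rewrite {1}(powr Y k y1 y2) x3' !mulmxA; congr (_ *m _).
  rewrite [in RHS](powr Y k y1 y2).
  change (Y ^+ k.+1 * A ^+ k.+1 = Y ^+ k.+1 * A ^+ k * A).
  by rewrite -mulrA -exprSr.
by rewrite e1 -e2.
Qed.

End Drazin.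

Section WeakGroup.
Variables (C : numClosedFieldType) (n : nat).
Implicit Types A X Y : 'M[C]_n.

Definition core_ep A : 'M[C]_n :=
  let k := mxindex A in drazin A *m A ^+ k *m mpinv (A ^+ k).

Definition weak_group m A : 'M[C]_n := core_ep A ^+ m.+1 *m A ^+ m.

Definition is_weak_group_mp m A Y : bool :=
  let A1 := A *m weak_group m A *m A in
  [&& Y *m A *m Y == Y, A *m Y == A1 *m mpinv A & Y *m A == drazin A *m A1].

(* The core-EP inverse ranges in that of A^k, so A^D A acts on it as 1. *)
Lemma drazin_core_ep A : drazin A *m A *m core_ep A = core_ep A.
Proof.
rewrite /core_ep; have /and3P[/eqP d1 /eqP d2 _] := drazinP A.
by rewrite !mulmxA d1.
Qed.

Lemma core_ep_outer_sq A : A *m core_ep A *m core_ep A = core_ep A.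
Proof.
have /and3P[/eqP d1 /eqP d2 /eqP d3] := drazinP A.
have /and4P[/eqP p1 _ _ _] := mpinvP (A ^+ mxindex A).
rewrite /core_ep; set k := mxindex A in d3 p1 *; set P := mpinv _ in p1 *.
set D := drazin A in d1 d2 d3 *.
have cDA : GRing.comm D (A ^+ k) by apply: commrX; exact: esym.
have DAk : A *m (D *m A ^+ k) = A ^+ k.
  rewrite -[RHS]d3 mulmxA d2 -mulmxA.
  by change (D * (A * A ^+ k) = D * A ^+ k.+1); rewrite exprS.
have -> : A *m (D *m A ^+ k *m P) = A ^+ k *m P by rewrite mulmxA DAk.
by rewrite [D *m _]cDA !mulmxA p1.
Qed.

Lemma core_ep_outer A : core_ep A *m A *m core_ep A = core_ep A.
Proof.
have /and3P[/eqP d1 /eqP d2 /eqP d3] := drazinP A.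
have /and4P[/eqP p1 _ _ _] := mpinvP (A ^+ mxindex A).
rewrite /core_ep; set k := mxindex A in d3 p1 *; set P := mpinv _ in p1 *.
set D := drazin A in d1 d2 d3 *.
have DAk : A *m (D *m A ^+ k) = A ^+ k.
  rewrite -[RHS]d3 mulmxA d2 -mulmxA.
  by change (D * (A * A ^+ k) = D * A ^+ k.+1); rewrite exprS.
transitivity (D *m A ^+ k *m P *m (A *m (D *m A ^+ k)) *m P).
  by rewrite !mulmxA.
by rewrite DAk; congr (_ *m _); rewrite -(mulmxA D) -(mulmxA D) p1.
Qed.

Lemma weak_group_outer m A :
  weak_group m A *m A *m weak_group m A = weak_group m A.
Proof.
have q j : A ^+ j.+1 *m core_ep A ^+ j.+1 = A *m core_ep A.
  elim: j => [//|j IH].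
  have sq : A * core_ep A * core_ep A = core_ep A := core_ep_outer_sq A.
  change (A ^+ j.+2 * core_ep A ^+ j.+2 = A * core_ep A).
  rewrite (exprSr A) !(exprS (core_ep A)) mulrA -(mulrA _ A) -mulrA mulrA.
  by rewrite -(mulrA (A ^+ j.+1)) (mulrA (A * _)) sq -exprS; exact: IH.
have oc : core_ep A * A * core_ep A = core_ep A := core_ep_outer A.
rewrite /weak_group; change (core_ep A ^+ m.+1 * A ^+ m * A
  * (core_ep A ^+ m.+1 * A ^+ m) = core_ep A ^+ m.+1 * A ^+ m).
rewrite -(mulrA _ (A ^+ m) A) -exprSr mulrA; congr (_ * _).
rewrite -mulrA [A ^+ m.+1 * _]q exprSr -mulrA.
by congr (_ * _); rewrite -[RHS]oc -mulrA.
Qed.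

Lemma drazin_weak_group m A :
  drazin A *m A *m weak_group m A = weak_group m A.
Proof.
have := drazin_core_ep A; rewrite /weak_group exprS.
move: (core_ep A) => c Ec.
change (drazin A *m A *m (c *m c ^+ m *m A ^+ m) = c *m c ^+ m *m A ^+ m).
by rewrite !mulmxA Ec.
Qed.

Lemma weak_group_mp_exists m A : exists Y, is_weak_group_mp m A Y.
Proof.
exists (weak_group m A *m A *m mpinv A); apply/and3P => /=.
have W := weak_group_outer m A; have D := drazin_weak_group m A.
have /and4P[/eqP p1 _ _ _] := mpinvP A.
move: (weak_group m A) W D => W WAW DAW.
have YA : W *m A *m mpinv A *m A = W *m A.
  by rewrite -!mulmxA (mulmxA A) p1.
split; apply/eqP; rewrite ?YA; first by rewrite !mulmxA WAW.
  by rewrite !mulmxA.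
by rewrite !mulmxA DAW.
Qed.

Definition weak_group_mp m A : 'M[C]_n := xchoose (weak_group_mp_exists m A).

Lemma weak_group_mpP m A : is_weak_group_mp m A (weak_group_mp m A).
Proof. exact: xchooseP. Qed.

Lemma weak_group_mp_unique m A X Y :
  is_weak_group_mp m A X -> is_weak_group_mp m A Y -> X = Y.
Proof.
move=> /and3P[/eqP x1 /eqP x2 /eqP x3] /and3P[/eqP y1 /eqP y2 /eqP y3].
by rewrite -x1 x3 -y3 -mulmxA x2 -y2 mulmxA y1.
Qed.

End WeakGroup.

Section Projector.
Variables (F : fieldType) (n : nat).
Implicit Types L M : {vspace 'cV[F]_n}.

Definition mxrange p (A : 'M[F]_(n, p)) : {vspace 'cV[F]_n} :=
  limg (linfun (mulmx A : 'cV[F]_p -> 'cV[F]_n)).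

Definition mxnull p (A : 'M[F]_(p, n)) : {vspace 'cV[F]_n} :=
  lker (linfun (mulmx A : 'cV[F]_n -> 'cV[F]_p)).

Lemma mxrangeP p (A : 'M[F]_(n, p)) v :
  reflect (exists x, v = A *m x) (v \in mxrange A).
Proof.
apply: (iffP memv_imgP) => [[x _ ->]|[x ->]]; exists x;
  by rewrite ?lfunE ?memvf.
Qed.

Lemma mxnullP p (A : 'M[F]_(p, n)) v : (v \in mxnull A) = (A *m v == 0).
Proof. by rewrite memv_ker lfunE. Qed.

(* The matrix of the projector onto L along M; it is meaningful only when L
   and M are complementary. *)
Definition projector L M : 'M[F]_n :=
  \matrix_(i, j) daddv_pi L M (delta_mx j 0) i 0.

Lemma mul_projector L M v : projector L M *m v = daddv_pi L M v.
Proof.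
rewrite {2}[v]matrix_sum_delta linear_sum /=.
apply/matrixP => i j; rewrite !mxE summxE; apply: eq_bigr => l _.
by rewrite big_ord1 linearZ /= !mxE !ord1 mulrC.
Qed.

Lemma projectorP L M (P : 'M[F]_n) :
  (L :&: M)%VS = 0%VS -> (L + M)%VS = fullv ->
  P = projector L M <->
  (forall v, v \in L -> P *m v = v) /\ (forall v, v \in M -> P *m v = 0).
Proof.
move=> LM0 LMf.
have pL v : v \in L -> projector L M *m v = v.
  by move=> vL; rewrite mul_projector daddv_pi_id.
have pM v : v \in M -> projector L M *m v = 0.
  move=> vM; rewrite mul_projector.
  have ML0 : (M :&: L)%VS = 0%VS by rewrite capvC.
  have := daddv_pi_add LM0 (_ : v \in L + M)%VS; rewrite LMf memvf.
  by move=> /(_ isT); rewrite (daddv_pi_id ML0 vM) => /(canRL (addrK _)) ->; rewrite subrr.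
split=> [-> //|[PL PM]]; apply/matrixP => i j.
have PE (v : 'cV[F]_n) : P *m v = projector L M *m v.
  have : v \in (L + M)%VS by rewrite LMf memvf.
  by case/memv_addP => u uL [w wM ->]; rewrite !mulmxDr PL // PM // pL // pM.
by have /matrixP /(_ i 0) := PE (delta_mx j 0); rewrite -!colE !mxE.
Qed.

End Projector.

(* Main.v *)
Require Import Defs.
From mathcomp Require Import all_boot all_order all_algebra.
From mathcomp Require Import reals complex.

Set Implicit Arguments.
Unset Strict Implicit.
Unset Printing Implicit Defensive.

Import GRing.Theory Num.Theory.
Local Open Scope ring_scope.
Local Open Scope sesquilinear_scope.

(** Write M = A^k, c for the core-EP inverse, W = c^(m+1) A^m for the m-weak
    group inverse, D for the Drazin inverse and A^+ for the Moore-Penrose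
    inverse.  The m-weak group MP inverse is Y = W A A^+.

    The key point is that Y itself satisfies both projector equations.  Since
    A c^2 = c, the powers telescope: A^(m+1) c^(m+1) = A c = M M^+, the
    orthogonal projector onto R(M).  Dually, c^(m+1) A^(m+1) is
    the identity on R(M).  Hence Y A = W A = c^(m+1) A^(m+1) fixes R(M), takes
    its values in R(M), and vanishes exactly where M M^+ A^(m+1), equivalently
    M^* A^(m+1), does; this also proves that R(M) and N(M^* A^(m+1)) are
    complementary ([mul_weak_group_projector]).  In A Y = A (W A) A^+ the
    outer factors keep the range, as A A^+ and A D fix R(M), and the null space
    becomes that of M^* A^(m+1) A^+ ([mul_weak_group_mpinv_projector]).

    Consequently the projector equations for X just say AX = AY and XA = YA
    ([weak_group_mp_equations]).  Under them, each of the three side conditions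
    says that R(X) = R(M) ([outer_inverse_characterizations]): both AX and XA
    act as the identity on R(M), so R(M) is contained in R(X), and r(X) = r(M)
    forces R(X) = R(M), whence A X^2 = X; and A X^2 = X places R(X) in
    R(AX) = R(M), whence XAX = X.  Finally XAX = X together with AX = AY and
    XA = YA determines X, as X = XAX = YAX = YAY = Y. *)

(** * Ranges and projectors *)

Lemma factor_of_mulmx_rank_le (F : fieldType) (n p q : nat)
    (B : 'M[F]_(n, q)) (X : 'M[F]_(n, p)) (V : 'M[F]_(p, q)) :
  B = X *m V -> (\rank X <= \rank B)%N -> exists Z, X = B *m Z.
Proof.
move=> BE rXB; have S : (B^T <= X^T)%MS by rewrite BE trmx_mul submxMl.
have /submxP[Z XZ] : (X^T <= B^T)%MS.
  by rewrite -(mxrank_leqif_sup S) eqn_leq !mxrank_tr rXB BE mxrankM_maxl.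
by exists Z^T; rewrite -[LHS]trmxK XZ trmx_mul trmxK.
Qed.

(** A certificate by matrix factorizations that also yields complementarity:
    E = BZ and EB = B make E idempotent with range R(B), and the mutual
    factorizations of E and G give N(G) = N(E), which complements R(E). *)
Lemma eq_projector (F : fieldType) (n p q : nat) (E : 'M[F]_n)
    (B : 'M[F]_(n, p)) (G : 'M[F]_(q, n)) Z U V :
  E = B *m Z -> E *m B = B -> E = U *m G -> G = V *m E ->
  E = projector (mxrange B) (mxnull G).
Proof.
move=> EBZ EB EUG GVE.
have EE : E *m E = E by rewrite {2}EBZ mulmxA EB.
have onL v : v \in mxrange B -> E *m v = v.
  by case/mxrangeP => x ->; rewrite mulmxA EB.
have onM v : v \in mxnull G -> E *m v = 0.
  by rewrite mxnullP EUG -mulmxA => /eqP ->; rewrite mulmx0.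
apply/projectorP; last by split.
  apply/eqP; rewrite -subv0; apply/subvP => v /[1!memv_cap] /andP[vL vM].
  by rewrite -(onL v vL) (onM v vM) mem0v.
apply/eqP; rewrite eqEsubv subvf; apply/subvP => v _.
rewrite -(subrK (E *m v) v) addrC; apply: memv_add.
  by apply/mxrangeP; exists (Z *m v); rewrite EBZ mulmxA.
by rewrite mxnullP GVE -mulmxA mulmxBr (mulmxA E) EE subrr mulmx0.
Qed.

(** * The Drazin and core-EP inverses on the range of A^k *)

Lemma drazin_mul_index_power (F : fieldType) (n : nat) (A : 'M[F]_n) :
  drazin A * A * A ^+ mxindex A = A ^+ mxindex A.
Proof.
have /and3P[_ _ /eqP d3] := drazinP A.
by rewrite -[RHS]d3 mulmxE exprS mulrA.
Qed.

Lemma mul_drazin_index_power (F : fieldType) (n : nat) (A : 'M[F]_n) :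
  A * drazin A * A ^+ mxindex A = A ^+ mxindex A.
Proof.
have /and3P[_ /eqP d2 _] := drazinP A.
have {}d2 : A * drazin A = drazin A * A := d2.
by rewrite d2 drazin_mul_index_power.
Qed.

Lemma mul_mpinv_index_power (C : numClosedFieldType) (n : nat) (A : 'M[C]_n) :
  A * mpinv A * A ^+ mxindex A = A ^+ mxindex A.
Proof.
have /and4P[/eqP p1 _ _ _] := mpinvP A.
rewrite -{1}(mul_drazin_index_power A) !mulrA.
by rewrite -[A * mpinv A * A]/(A *m mpinv A *m A) p1 mul_drazin_index_power.
Qed.

Lemma mul_core_ep (C : numClosedFieldType) (n : nat) (A : 'M[C]_n) :
  A * core_ep A = A ^+ mxindex A * mpinv (A ^+ mxindex A).
Proof. by rewrite /core_ep !mulmxE !mulrA mul_drazin_index_power. Qed.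

Lemma core_ep_factor (C : numClosedFieldType) (n : nat) (A : 'M[C]_n) :
  core_ep A = A ^+ mxindex A * (drazin A * mpinv (A ^+ mxindex A)).
Proof.
have /and3P[_ /eqP d2 _] := drazinP A.
have cDA : GRing.comm (drazin A) (A ^+ mxindex A).
  by apply: commrX; exact: esym d2.
by rewrite /core_ep !mulmxE cDA mulrA.
Qed.

Lemma core_ep_mul_index_power (C : numClosedFieldType) (n : nat)
    (A : 'M[C]_n) : core_ep A * A * A ^+ mxindex A = A ^+ mxindex A.
Proof.
have /and4P[/eqP p1 _ _ _] := mpinvP (A ^+ mxindex A).
have cA : A * A ^+ mxindex A = A ^+ mxindex A * A by rewrite -exprS exprSr.
rewrite /core_ep !mulmxE -[LHS]mulrA cA mulrA -!(mulrA (drazin A)).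
rewrite (_ : _ * mpinv _ * _ = A ^+ mxindex A); last exact: p1.
by rewrite -cA mulrA drazin_mul_index_power.
Qed.

(** c A is the identity on R(A^k) and R(A^k) is A-invariant, so the inner
    factors c A of c^j A^j cancel one after the other. *)
Lemma core_ep_exp_mul_index_power (C : numClosedFieldType) (n j : nat)
    (A : 'M[C]_n) :
  core_ep A ^+ j * A ^+ j * A ^+ mxindex A = A ^+ mxindex A.
Proof.
elim: j => [|j IH]; first by rewrite !expr0 !mul1r.
have cA : A ^+ j * A ^+ mxindex A = A ^+ mxindex A * A ^+ j.
  by rewrite -!exprD addnC.
transitivity (core_ep A ^+ j * (core_ep A * A * A ^+ mxindex A) * A ^+ j).
  by rewrite exprSr exprS -!mulrA cA.
by rewrite core_ep_mul_index_power -mulrA -cA mulrA IH.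
Qed.

Lemma exp_mul_core_ep_exp (C : numClosedFieldType) (n j : nat)
    (A : 'M[C]_n) : A ^+ j.+1 * core_ep A ^+ j.+1 = A * core_ep A.
Proof.
have sq : A * core_ep A * core_ep A = core_ep A := core_ep_outer_sq A.
elim: j => [//|j IH].
transitivity (A ^+ j.+1 * (A * core_ep A * core_ep A) * core_ep A ^+ j).
  by rewrite (exprSr A) (exprS _ j.+1) (exprS (core_ep A)) !mulrA.
by rewrite sq -mulrA -exprS IH.
Qed.

(** * The projectors attached to the weak group MP inverse *)

Lemma weak_group_mulE (C : numClosedFieldType) (n m : nat) (A : 'M[C]_n) :
  weak_group m A * A = core_ep A ^+ m.+1 * A ^+ m.+1.
Proof. by rewrite /weak_group mulmxE -mulrA -exprSr. Qed.

Lemma weak_group_mul_index_power (C : numClosedFieldType) (n m : nat)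
    (A : 'M[C]_n) :
  weak_group m A * A * A ^+ mxindex A = A ^+ mxindex A.
Proof. by rewrite weak_group_mulE core_ep_exp_mul_index_power. Qed.

Lemma weak_group_factor (C : numClosedFieldType) (n m : nat) (A : 'M[C]_n) :
  exists Z, weak_group m A = A ^+ mxindex A * Z.
Proof.
by eexists; rewrite /weak_group mulmxE exprS {1}core_ep_factor -!mulrA.
Qed.

(** Both W A and (A^k)^* A^(m+1) arise from the orthogonal projector
    A^k (A^k)^+ times A^(m+1), so each is a left multiple of the other. *)
Lemma weak_group_mul_left_multiple (C : numClosedFieldType) (n m : nat)
    (A : 'M[C]_n) :
  exists U, weak_group m A *m A = U *m ((A ^+ mxindex A) ^t* *m A ^+ m.+1).
Proof.
have /and4P[_ _ /eqP p3 _] := mpinvP (A ^+ mxindex A).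
exists (core_ep A ^+ m * drazin A * (mpinv (A ^+ mxindex A)) ^t*).
rewrite [LHS]weak_group_mulE exprSr {2}/core_ep.
by rewrite -(mulmxA (drazin A)) -p3 ctmxM !mulmxE !mulrA.
Qed.

Lemma power_left_multiple_weak_group_mul (C : numClosedFieldType) (n m : nat)
    (A : 'M[C]_n) :
  (A ^+ mxindex A) ^t* *m A ^+ m.+1
  = (A ^+ mxindex A) ^t* *m A ^+ m.+1 *m (weak_group m A *m A).
Proof.
have /and4P[/eqP p1 _ /eqP p3 _] := mpinvP (A ^+ mxindex A).
have MP : (A ^+ mxindex A) ^t* * (A * core_ep A) = (A ^+ mxindex A) ^t*.
  by rewrite mul_core_ep -!mulmxE -p3 -ctmxM p1.
rewrite [weak_group m A *m A]weak_group_mulE !mulmxE mulrA.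
by rewrite -(mulrA _ (A ^+ _)) exp_mul_core_ep_exp MP.
Qed.

Lemma mul_weak_group_projector (C : numClosedFieldType) (n m : nat)
    (A : 'M[C]_n) :
  weak_group m A *m A
  = projector (mxrange (A ^+ mxindex A))
      (mxnull ((A ^+ mxindex A) ^t* *m A ^+ m.+1)).
Proof.
have [Z WZ] := weak_group_factor m A.
have [U WU] := weak_group_mul_left_multiple m A.
apply: (@eq_projector _ _ _ _ _ _ _ (Z *m A) U
          ((A ^+ mxindex A) ^t* *m A ^+ m.+1)).
- by rewrite WZ mulmxA.
- exact: weak_group_mul_index_power.
- exact: WU.
- exact: power_left_multiple_weak_group_mul.
Qed.

Lemma mul_weak_group_mpinv_factor (C : numClosedFieldType) (n m : nat)
    (A : 'M[C]_n) :
  exists Z, A *m weak_group m A *m A *m mpinv A = A ^+ mxindex A *m Z.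
Proof.
have [Z ->] := weak_group_factor m A.
exists (A *m Z *m A *m mpinv A).
have cA : A *m A ^+ mxindex A = A ^+ mxindex A *m A.
  by rewrite mulmxE -exprS exprSr.
by rewrite !mulmxA cA.
Qed.

(** On R(A^k), which A and D leave invariant and on which they are mutually
    inverse, W A is the identity; hence so is A W = A (W A) D there. *)
Lemma mul_weak_group_mpinv_index_power (C : numClosedFieldType) (n m : nat)
    (A : 'M[C]_n) :
  A *m weak_group m A *m A *m mpinv A *m A ^+ mxindex A = A ^+ mxindex A.
Proof.
have /and3P[_ /eqP dA _] := drazinP A.
have cD : drazin A * A ^+ mxindex A = A ^+ mxindex A * drazin A.
  by apply: commrX; exact: esym dA.
transitivity (A * weak_group m A * (A * mpinv A * A ^+ mxindex A)).
  by rewrite -!mulmxE !mulmxA.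
rewrite mul_mpinv_index_power.
transitivity (A * (weak_group m A * A * A ^+ mxindex A) * drazin A).
  by rewrite -{1}(mul_drazin_index_power A) -!mulrA cD.
by rewrite weak_group_mul_index_power -mulrA -cD mulrA mul_drazin_index_power.
Qed.

Lemma mul_weak_group_mpinv_projector (C : numClosedFieldType) (n m : nat)
    (A : 'M[C]_n) :
  A *m weak_group m A *m A *m mpinv A
  = projector (mxrange (A ^+ mxindex A))
      (mxnull ((A ^+ mxindex A) ^t* *m A ^+ m.+1 *m mpinv A)).
Proof.
have [Z WZ] := mul_weak_group_mpinv_factor m A.
have [U WU] := weak_group_mul_left_multiple m A.
apply: (@eq_projector _ _ _ _ _ _ _ Z (A *m U)
          ((A ^+ mxindex A) ^t* *m A ^+ m.+1 *m drazin A)).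
- exact: WZ.
- exact: mul_weak_group_mpinv_index_power.
- by rewrite -(mulmxA A) WU !mulmxA.
(* W takes its values in R(A^k), so W = D A W: multiplying by D on the left
   undoes the leading factor A. *)
- rewrite {1}power_left_multiple_weak_group_mul.
  have := drazin_weak_group m A; move: (weak_group m A) => W DAW.
  by rewrite -{1}DAW !mulmxA.
Qed.

(** * Characterizations of the weak group MP inverse *)

(** An X sharing both products with Y satisfies X A M = M, so R(M) lies in
    R(X), and X equals Y as soon as R(X) is no larger.  Each side condition
    forces R(X) = R(M): the rank by dimension, A X^2 = X because R(A X) lies in
    R(M), and X A X = X because X = (X A) X = Y (A Y). *)
Lemma outer_inverse_characterizations (F : fieldType) (n p : nat)
    (A X Y : 'M[F]_n) (M : 'M[F]_(n, p)) (Z : 'M[F]_(p, n)) :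
  Y *m A *m Y = Y -> Y *m A *m M = M -> A *m Y *m M = M -> A *m Y = M *m Z ->
  [<-> X = Y;
    [/\ A *m X = A *m Y, X *m A = Y *m A & \rank X = \rank M];
    [/\ A *m X = A *m Y, X *m A = Y *m A & A *m X ^+ 2 = X];
    [/\ A *m X = A *m Y, X *m A = Y *m A & X *m A *m X = X]].
Proof.
move=> YAY YAM AYM AYZ; tfae.
- move=> ->; split=> //; apply/eqP; rewrite eqn_leq; apply/andP; split.
    rewrite -YAY -mulmxA AYZ mulmxA.
    by rewrite (leq_trans (mxrankM_maxl _ _)) ?mxrankM_maxr.
  by rewrite -YAM -mulmxA mxrankM_maxl.
- case=> AX XA rX; split=> //.
  have [T XT] : exists T, X = M *m T.
    apply: (@factor_of_mulmx_rank_le _ _ _ _ _ _ (A *m M)); last by rewrite rX.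
    by rewrite mulmxA XA YAM.
  by rewrite expr2 -mulmxE mulmxA AX {1}XT mulmxA AYM -XT.
- case=> AX XA AXX; split=> //.
  have XT : X = M *m (Z *m X).
    by rewrite mulmxA -AYZ -AX -mulmxA -[in LHS]AXX expr2.
  by rewrite XA {1}XT mulmxA YAM -XT.
- case=> AX XA XAX.
  by rewrite -XAX XA -mulmxA AX mulmxA.
Qed.

Lemma weak_group_mp_equations (C : numClosedFieldType) (n m : nat)
    (A : 'M[C]_n) :
  [/\ weak_group_mp m A *m A *m weak_group_mp m A = weak_group_mp m A,
      A *m weak_group_mp m A = A *m weak_group m A *m A *m mpinv A
    & weak_group_mp m A *m A = weak_group m A *m A].
Proof.
have /and3P[/eqP YAY /eqP AY /eqP YA] := weak_group_mpP m A.
split=> //; rewrite YA.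
have := drazin_weak_group m A; move: (weak_group m A) => W DAW.
by rewrite !mulmxA DAW.
Qed.

Lemma weak_group_mp_characterizations (C : numClosedFieldType) (n m : nat)
    (A X : 'M[C]_n) :
  [<->
    X = weak_group_mp m A;
    [/\ A *m X = projector (mxrange (A ^+ mxindex A))
                   (mxnull ((A ^+ mxindex A) ^t* *m A ^+ m.+1 *m mpinv A)),
        X *m A = projector (mxrange (A ^+ mxindex A))
                   (mxnull ((A ^+ mxindex A) ^t* *m A ^+ m.+1))
      & \rank X = \rank (A ^+ mxindex A)];
    [/\ A *m X = projector (mxrange (A ^+ mxindex A))
                   (mxnull ((A ^+ mxindex A) ^t* *m A ^+ m.+1 *m mpinv A)),
        X *m A = projector (mxrange (A ^+ mxindex A))
                   (mxnull ((A ^+ mxindex A) ^t* *m A ^+ m.+1))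
      & A *m X ^+ 2 = X];
    [/\ A *m X = projector (mxrange (A ^+ mxindex A))
                   (mxnull ((A ^+ mxindex A) ^t* *m A ^+ m.+1 *m mpinv A)),
        X *m A = projector (mxrange (A ^+ mxindex A))
                   (mxnull ((A ^+ mxindex A) ^t* *m A ^+ m.+1))
      & X *m A *m X = X]].
Proof.
rewrite -mul_weak_group_projector -mul_weak_group_mpinv_projector.
have [YAY AY YA] := weak_group_mp_equations m A.
have [Z AYZ] := mul_weak_group_mpinv_factor m A.
have AYM := mul_weak_group_mpinv_index_power m A.
have YAM : weak_group m A *m A *m A ^+ mxindex A = A ^+ mxindex A.
  exact: weak_group_mul_index_power.
rewrite -AY -YA in AYZ AYM YAM *.
exact: outer_inverse_characterizations YAY YAM AYM AYZ.
Qed.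

Theorem theorem4p5 (R : realType) (n k m : nat) (A X : 'M[R[i]]_n)
    (hk : mxindex A = k) (hm : (0 < m)%N) :
  [<->
    (* (a) *)
    X = weak_group_mp m A;
    (* (b) *)
    [/\ A *m X = projector (mxrange (A ^+ k))
                   (mxnull ((A ^+ k) ^t* *m A ^+ m.+1 *m mpinv A)),
        X *m A = projector (mxrange (A ^+ k))
                   (mxnull ((A ^+ k) ^t* *m A ^+ m.+1))
      & \rank X = \rank (A ^+ k)];
    (* (c) *)
    [/\ A *m X = projector (mxrange (A ^+ k))
                   (mxnull ((A ^+ k) ^t* *m A ^+ m.+1 *m mpinv A)),
        X *m A = projector (mxrange (A ^+ k))
                   (mxnull ((A ^+ k) ^t* *m A ^+ m.+1))
      & A *m X ^+ 2 = X];
    (* (d) *)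
    [/\ A *m X = projector (mxrange (A ^+ k))
                   (mxnull ((A ^+ k) ^t* *m A ^+ m.+1 *m mpinv A)),
        X *m A = projector (mxrange (A ^+ k))
                   (mxnull ((A ^+ k) ^t* *m A ^+ m.+1))
      & X *m A *m X = X]].
Proof. by subst k; exact: weak_group_mp_characterizations. Qed.
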